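(* Let $KB=\{(\varphi_i\ \alpha_i): 1\le i\le n\}$ be a $C_1$-possibilistic knowledge base, with minimum specificity closure $N_{KB}$. For every $C_1$-necessity function $N$, $N$ satisfies $KB$ if and only if $N\ge N_{KB}$ (i.e. $N(\psi)\ge N_{KB}(\psi)$ for all $\psi\in\mathcal{L}$).
   Context: $\mathcal{L}$ is a classical propositional language, built from a list of propositional variables and the connectives $\neg,\wedge,\vee,\to$; $\varphi^\circ$ abbreviates $\neg(\varphi\wedge\neg\varphi)$, and $\#$ denotes any of $\wedge,\vee,\to$. Paraconsistent logic $C_1$: a $C_1$-valuation is a mapping $v:\mathcal{L}\to\{0,1\}$ such that for all $\varphi,\psi$: - $v(\varphi)=0\Rightarrow v(\neg\varphi)=1$; - $v(\neg\neg\varphi)=1\Leftrightarrow v(\varphi)=1$; - $v(\psi^\circ)=v(\varphi\to\psi)=v(\varphi\to\neg\psi)=1\Rightarrow v(\varphi)=0$; - $v(\varphi\to\psi)=1\Leftrightarrow v(\varphi)=0$ or $v(\psi)=1$; - $v(\varphi\wedge\psi)=1\Leftrightarrow v(\varphi)=1$ and $v(\psi)=1$; - $v(\varphi\vee\psi)=1\Leftrightarrow v(\varphi)=1$ or $v(\psi)=1$; - $v(\varphi^\circ)=v(\psi^\circ)=1\Rightarrow v((\varphi\#\psi)^\circ)=1$. For $\Gamma\subseteq\mathcal{L}$, $\Gamma\vdash_{C_1}\psi$ means that every $C_1$-valuation giving value $1$ to all members of $\Gamma$ gives value $1$ to $\psi$; $\vdash_{C_1}\psi$ means $\emptyset\vdash_{C_1}\psi$;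 $\vdash_{C_1}\varphi\leftrightarrow\psi$ is a shorthand for ''$\vdash_{C_1}\varphi\to\psi$ and $\vdash_{C_1}\psi\to\varphi$''. A $C_1$-necessity function is a mapping $N:\mathcal{L}\to[0,1]$ such that for all $\varphi,\psi$: (Taut) if $\vdash_{C_1}\varphi$ then $N(\varphi)=1$; (Eq) if $\vdash_{C_1}\varphi\leftrightarrow\psi$ then $N(\varphi)=N(\psi)$; (Conj) $N(\varphi\wedge\psi)=\min(N(\varphi),N(\psi))$. A $C_1$-possibilistic knowledge base is a finite set $KB=\{(\varphi_i\ \alpha_i): 1\le i\le n\}$ with $\varphi_i\in\mathcal{L}$ and $\alpha_i\in[0,1]$. A $C_1$-necessity function $N$ satisfies $KB$ iff $N(\varphi_i)\ge\alpha_i$ for all $i=1,\dots,n$. The minimum specificity closure of $KB$ is the mapping $N_{KB}:\mathcal{L}\to[0,1]$, $N_{KB}(\psi)=\sup\{\beta\in[0,1]: KB_\beta\vdash_{C_1}\psi\}$, where $KB_\beta=\{\varphi_i: (\varphi_i\ \alpha_i)\in KB,\ \alpha_i\ge\beta\}$ and $\sup\emptyset=0$. *)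

(* Defs.v *)
From HB Require Import structures.
From mathcomp Require Import all_boot all_order all_algebra.
From mathcomp Require Import all_classical all_reals.

Set Implicit Arguments.
Unset Strict Implicit.
Unset Printing Implicit Defensive.

Import Order.TTheory GRing.Theory Num.Theory.
Local Open Scope classical_set_scope.
Local Open Scope ring_scope.

Inductive prop_form (V : Type) : Type :=
| Var of V
| Neg of prop_form V
| And of prop_form V & prop_form V
| Or of prop_form V & prop_form V
| Imp of prop_form V & prop_form V.

Definition wellbehaved (V : Type) (p : prop_form V) : prop_form V := Neg (And p (Neg p)).

(* The truth values 0 and 1 are [false] and [true]. *)
Record C1_valuation (V : Type) (v : prop_form V -> bool) : Prop := {
  val_neg : forall p, v p = false -> v (Neg p) = true;
  val_negneg : forall p, v (Neg (Neg p)) = true <-> v p = true;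
  val_abs : forall p q, v (wellbehaved q) = true -> v (Imp p q) = true ->
    v (Imp p (Neg q)) = true -> v p = false;
  val_imp : forall p q, v (Imp p q) = true <-> v p = false \/ v q = true;
  val_and : forall p q, v (And p q) = true <-> v p = true /\ v q = true;
  val_or : forall p q, v (Or p q) = true <-> v p = true \/ v q = true;
  val_circ_and : forall p q, v (wellbehaved p) = true -> v (wellbehaved q) = true ->
    v (wellbehaved (And p q)) = true;
  val_circ_or : forall p q, v (wellbehaved p) = true -> v (wellbehaved q) = true ->
    v (wellbehaved (Or p q)) = true;
  val_circ_imp : forall p q, v (wellbehaved p) = true -> v (wellbehaved q) = true ->
    v (wellbehaved (Imp p q)) = true
}.

Definition C1_entails (V : Type) (Gamma : set (prop_form V)) (q : prop_form V) : Prop :=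
  forall v : prop_form V -> bool, C1_valuation v ->
    (forall p, Gamma p -> v p = true) -> v q = true.

Definition C1_valid (V : Type) (q : prop_form V) : Prop := C1_entails set0 q.

Definition C1_equiv (V : Type) (p q : prop_form V) : Prop :=
  C1_valid (Imp p q) /\ C1_valid (Imp q p).

Record C1_necessity (R : realType) (V : Type) (N : prop_form V -> R) : Prop := {
  nec_range : forall p, 0 <= N p <= 1;
  nec_taut : forall p, C1_valid p -> N p = 1;
  nec_eq : forall p q, C1_equiv p q -> N p = N q;
  nec_conj : forall p q, N (And p q) = Num.min (N p) (N q)
}.

Definition C1_knowledge_base (R : realType) (V : Type)
    (KB : set (prop_form V * R)) : Prop :=
  finite_set KB /\ forall p a, KB (p, a) -> 0 <= a <= 1.

Definition KB_satisfied (R : realType) (V : Type) (N : prop_form V -> R)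
    (KB : set (prop_form V * R)) : Prop :=
  forall p a, KB (p, a) -> a <= N p.

Definition KB_cut (R : realType) (V : Type) (KB : set (prop_form V * R)) (b : R) :
    set (prop_form V) :=
  [set p | exists2 a, KB (p, a) & b <= a].

(* [sup set0] is [0] in the library, and a nonempty set below is bounded by 1,
   so [sup] is a genuine supremum here. *)
Definition min_spec_closure (R : realType) (V : Type) (KB : set (prop_form V * R))
    (q : prop_form V) : R :=
  sup [set b : R | 0 <= b <= 1 /\ C1_entails (KB_cut KB b) q].

(* Main.v *)
Require Import Defs.
From mathcomp Require Import all_boot all_order all_algebra.
From mathcomp Require Import all_classical all_reals.

(** If finitely many formulas [p1, ..., pk] entail [q], the deduction theorem
makes [p1 -> ... -> pk -> q] valid, so a necessity function gives it the value
[1]. A necessity function is monotone for entailment and turns conjunctions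
into minima, so modus ponens yields [min (N p1) ... (N pk) <= N q]. Applied to
the cuts of the base this bounds the supremum; conversely the cut of the base
at [a] contains every [p] of weight [a], so the closure is at least [a] at [p]. *)

Import Order.TTheory.

Local Open Scope classical_set_scope.
Local Open Scope ring_scope.

Lemma set_seq_cons (T : eqType) (x : T) (s : seq T) :
  [set` x :: s] = x |` [set` s].
Proof.
by apply/seteqP; split=> y /=; rewrite inE => /predU1P.
Qed.

Section Entailment.
Context {V : Type}.
Implicit Types (Gamma : set (prop_form V)) (p q : prop_form V).

Lemma C1_deduction Gamma p q :
  C1_entails (p |` Gamma) q <-> C1_entails Gamma (Imp p q).
Proof.
split=> [ent v hv hG|ent v hv hG].
  apply/(val_imp hv); case vp: (v p); last by left.
  by right; apply: ent => // r [->|/hG].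
have /(val_imp hv) [vp|//] : v (Imp p q) = true.
  by apply: ent => // r Gr; apply: hG; right.
by move: vp; rewrite hG //; left.
Qed.

End Entailment.

Section Necessity.
Context {R : realType} {V : Type} {N : prop_form V -> R} (hN : C1_necessity N).
Implicit Types p q : prop_form V.

(** Validity of [Imp p q] makes [p] equivalent to [And p q], so [N p] is the minimum of [N p] and
    [N q]. *)
Lemma C1_necessity_mono p q : C1_valid (Imp p q) -> N p <= N q.
Proof.
move=> pq; suff -> : N p = Num.min (N p) (N q) by rewrite ge_min lexx orbT.
rewrite -(nec_conj hN); apply: (nec_eq hN); split=> v hv h.
  apply/(val_imp hv); case/(val_imp hv): (pq v hv h) => [|vq]; first by left.
  by case vp: (v p); [right; apply/(val_and hv)|left].
apply/(val_imp hv); case vpq: (v (And p q)); last by left.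
by right; case/(val_and hv): vpq.
Qed.

Lemma C1_necessity_mp p q : Num.min (N p) (N (Imp p q)) <= N q.
Proof.
rewrite -(nec_conj hN); apply: C1_necessity_mono => v hv _.
apply/(val_imp hv); case vpq: (v _); last by left.
right; case/(val_and hv): vpq => vp /(val_imp hv) [|//].
by rewrite vp.
Qed.

Lemma C1_necessity_entails {Gamma : set (prop_form V)} {q} {b : R} :
  finite_set Gamma -> b <= 1 -> (forall p, Gamma p -> b <= N p) ->
  C1_entails Gamma q -> b <= N q.
Proof.
(* [{classic _}] supplies the choice structure [finite_seqP] needs. *)
move=> /(@finite_seqP {classic (prop_form V)}) [s ->] b1.
(* [q] stays general: the induction hypothesis is applied to [Imp p q]. *)
elim: s q => [|p s IHs] q; rewrite ?set_nil ?set_seq_cons => hs ent.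
  by rewrite (nec_taut hN).
apply: le_trans (C1_necessity_mp p q); rewrite le_min; apply/andP; split.
  by apply: hs; left.
by apply: IHs => [r rs|]; [apply: hs; right|exact/C1_deduction].
Qed.

End Necessity.

Lemma finite_KB_cut {R : realType} {V : Type} {KB : set (prop_form V * R)} (b : R) :
  finite_set KB -> finite_set (KB_cut KB b).
Proof.
move=> fKB; apply: (sub_finite_set _ (finite_image fst fKB)).
by move=> p [a KBpa _]; exists (p, a).
Qed.

Theorem proposition17 (R : realType) (V : Type) (KB : set (prop_form V * R))
    (hKB : C1_knowledge_base KB) (N : prop_form V -> R) (hN : C1_necessity N) :
  KB_satisfied N KB <-> (forall q : prop_form V, min_spec_closure KB q <= N q).
Proof.
case: hKB => fKB KB01; split=> [sat q|closure_le p a KBpa].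
  rewrite /min_spec_closure; set S := (S in sup S).
  (* If no level in [0,1] has a cut entailing [q], the supremum is [0] by convention and
     nonnegativity of [N] suffices. *)
  have [->|/set0P S0] := eqVneq S set0.
    by rewrite sup0; case/andP: (nec_range hN q).
  apply: ge_sup => // b [/andP[_ b1] ent].
  apply: (C1_necessity_entails hN (finite_KB_cut b fKB) b1 _ ent).
  by move=> p [a KBpa ba]; apply: le_trans ba (sat p a KBpa).
(* The set is bounded by [1], so its member [a] is at most the supremum. *)
apply: le_trans (closure_le p); apply: ub_le_sup.
  by exists 1 => b [/andP[]].
split; first exact: KB01 KBpa.
by move=> v _ hv; apply: hv; exists a.
Qed.
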